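(* Let $S$ be a monoid with a zero element $0\neq 1$. Then $S$ is left perfect if and only if $S$ is left $0$-perfect.
   Context: Let $S=(S,\cdot,1)$ be a monoid with a zero element $0$ (so $0\cdot s=s\cdot 0=0$ for all $s\in S$), $0\ne 1$. A left $S$-act is a nonempty set $A$ with a map $S\times A\to A$, $(s,a)\mapsto sa$, such that $1a=a$ and $(s_1s_2)a=s_1(s_2a)$. A homomorphism of $S$-acts is a map $f$ with $f(sa)=sf(a)$. $S\text{-}\mathrm{Act}$ is the category of all left $S$-acts with homomorphisms; $S\text{-}\overline{\mathrm{Act}}$ is this category enriched by the empty act as an initial object. For an act $A$, $0A=\{0a\mid a\in A\}$ is its set of zero elements. $S\text{-}\mathrm{Act}_0$ is the category of all left $S$-acts $A$ with a unique zero element $\theta_A$ ($0A=\{\theta_A\}$), with homomorphisms of $S$-acts (compatible with zero) as morphisms. Epimorphisms in these categories are the surjective morphisms. In each of these categories: an act $P$ is projective if for every epimorphism $\pi:A\to B$ and every morphism $\alpha:P\to B$ there is a morphism $\overline{\alpha}:P\to A$ with $\alpha=\pi\overline{\alpha}$. A cover of an act $A$ is a pair $(C,f)$ where $f:C\to A$ is an epimorphism such that for every proper subact $C'\subset C$ the restriction $f|_{C'}:C'\to A$ is not an epimorphism. A cover $(P,f)$ is a projective cover if $P$ is projective. $S$ is left perfect if every object of $S\text{-}\overline{\mathrm{Act}}$ has a projective cover in $S\text{-}\overline{\mathrm{Act}}$; $S$ is left $0$-perfect if every object of $S\text{-}\mathrm{Act}_0$ has a projective cover in $S\text{-}\mathrm{Act}_0$.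 *)

(* Defs.v *)
From mathcomp Require Import all_boot.
From mathcomp Require Import boolp classical_sets.

Set Implicit Arguments.
Unset Strict Implicit.
Unset Printing Implicit Defensive.

Local Open Scope classical_set_scope.
Local Open Scope group_scope.

(* The carrier may be empty: lact S is the type of objects of S-Act enriched
   by the empty act. *)
Record lact (S : monoidType) := Lact {
  lact_sort :> Type;
  smul : S -> lact_sort -> lact_sort;
  smul1 : forall a, smul 1 a = a;
  smulM : forall s t a, smul (s * t) a = smul s (smul t a)
}.

Section Acts.
Variable S : monoidType.
Implicit Types A B C P : lact S.

Definition lact_hom A B (f : A -> B) : Prop :=
  forall s a, f (smul s a) = smul s (f a).

(* Epimorphisms are the surjective morphisms in all the categories at stake. *)
Definition epi A B (f : A -> B) : Prop :=
  lact_hom f /\ forall b, exists a, f a = b.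

Definition smul_closed A (D : set A) : Prop :=
  forall s a, D a -> D (smul s a).

Section Subact.
Variables (A : lact S) (D : set A) (hD : smul_closed D).

Fact smul_sub_subproof (s : S) (x : D) : smul s (val x) \in D.
Proof. by rewrite inE; apply: hD; apply: set_valP. Qed.

Definition smul_sub (s : S) (x : D) : D :=
  exist (fun z : A => z \in D) _ (smul_sub_subproof s x).

Fact smul_sub1 x : smul_sub 1 x = x.
Proof. by apply: val_inj; rewrite /= smul1. Qed.

Fact smul_subM s t x : smul_sub (s * t) x = smul_sub s (smul_sub t x).
Proof. by apply: val_inj; rewrite /= smulM. Qed.

Definition subact : lact S := Lact smul_sub1 smul_subM.

Definition subact_incl (x : subact) : A := \val (x : D).

End Subact.

(* K : lact S -> Prop selects the objects of a full subcategory; the notions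
   below are relative to that subcategory. *)

Definition projective (K : lact S -> Prop) P : Prop :=
  forall A B, K A -> K B ->
  forall (pi : A -> B) (alpha : P -> B), epi pi -> lact_hom alpha ->
  exists2 beta : P -> A, lact_hom beta & alpha = pi \o beta.

Definition cover (K : lact S -> Prop) A C (f : C -> A) : Prop :=
  [/\ K C, epi f &
      forall (D : set C) (hD : smul_closed D), K (subact hD) ->
        D <> setT -> ~ epi (f \o @subact_incl C D hD)].

Definition has_projective_cover (K : lact S -> Prop) A : Prop :=
  exists (P : lact S) (f : P -> A), cover K f /\ projective K P.

Definition in_Act_bar : lact S -> Prop := fun=> True.

Definition zeros (o : S) A : set A := [set smul o a | a in [set: A]].
Arguments zeros : clear implicits.

(* Morphisms between such acts preserve the zero element automatically, so
   these acts do span a full subcategory. *)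
Definition in_Act_0 (o : S) : lact S -> Prop :=
  fun A => exists theta : A, zeros o A = [set theta].

Definition left_perfect : Prop :=
  forall A, in_Act_bar A -> has_projective_cover in_Act_bar A.

Definition left_0_perfect (o : S) : Prop :=
  forall A, in_Act_0 o A -> has_projective_cover (in_Act_0 o) A.

End Acts.

(* Main.v *)
(** From left to right, collapse all zeros of a projective cover in the enriched
    category to a single one: this Rees quotient is a projective cover in the
    category of acts with a unique zero.

    Conversely, an act [A] is the coproduct of the acts [A_z = {a | 0 a = z}],
    which have at most one zero, and coproducts of projective covers are
    projective covers; so let [A] have a unique zero and let [P] be a projective
    cover of [A] among such acts.  A nonzero [P] is a retract, via [b], of the
    Rees quotient of the free act [F] on [P \ 0].  The elements [b p] with
    [p <> 0] are nonzero, hence live in [F] itself, and the subact [Q] of [F]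
    that they generate is a retract of [F].  The projection of [Q] onto [P] is
    injective over [P \ 0], which makes [Q] a projective cover of [A] in the
    enriched category. *)
From mathcomp Require Import all_boot.
From mathcomp Require Import boolp classical_sets.
Require Import Defs.

Set Implicit Arguments.
Unset Strict Implicit.
Unset Printing Implicit Defensive.

Local Open Scope classical_set_scope.
Local Open Scope group_scope.

(** * Restriction to subacts *)

Lemma epi_subactP (S : monoidType) (A C : lact S) (f : C -> A) (D : set C)
    (hD : smul_closed D) :
  lact_hom f ->
  epi (f \o @subact_incl S C D hD) <-> forall a, exists2 c, D c & f c = a.
Proof.
move=> hf; split=> [[_ fD] a|fD].
  by have [c <-] := fD a; exists (subact_incl c) => //; apply: set_valP.
split=> [s c|a]; first by rewrite /= -hf.
have [c Dc <-] := fD a.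
by exists (exist _ c (mem_set Dc)).
Qed.

Lemma subact_eq (S : monoidType) (A : lact S) (D : set A)
    (hD : smul_closed D) (x y : subact hD) :
  subact_incl x = subact_incl y -> x = y.
Proof. exact: val_inj. Qed.

(** * Coproducts of acts *)

Section Coproduct.
Variables (S : monoidType) (I : Type) (A : I -> lact S).

Definition coprod_smul (s : S) (x : {i & A i}) : {i & A i} :=
  existT _ (projT1 x) (smul s (projT2 x)).

Fact coprod_smul1 x : coprod_smul 1 x = x.
Proof. by case: x => i a; rewrite /coprod_smul /= smul1. Qed.

Fact coprod_smulM s t x :
  coprod_smul (s * t) x = coprod_smul s (coprod_smul t x).
Proof. by rewrite /coprod_smul /= smulM. Qed.

Definition coprod : lact S := Lact coprod_smul1 coprod_smulM.

Definition coprod_in i (a : A i) : coprod := existT _ i a.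

Lemma coprod_projective :
  (forall i, projective (@in_Act_bar S) (A i)) ->
  projective (@in_Act_bar S) coprod.
Proof.
move=> projA B C _ _ pi alpha pi_epi alphah.
have lift i : exists beta : A i -> B,
    lact_hom beta /\ forall a, alpha (coprod_in a) = pi (beta a).
  have [|beta betah e] := @projA i B C Logic.I Logic.I pi
    (fun a => alpha (coprod_in a)) pi_epi.
    by move=> s a; rewrite -alphah.
  by exists beta; split=> // a; have := congr1 (@^~ a) e.
exists (fun x : coprod => projT1 (cid (lift (projT1 x))) (projT2 x)).
  by move=> s [i a] /=; case: cid => beta [].
by apply/funext => -[i a] /=; case: cid => beta [].
Qed.

End Coproduct.

Section Zero.
Variables (S : monoidType) (o : S).
Hypotheses (o_mull : forall s : S, o * s = o) (o_mulr : forall s : S, s * o = o).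

Lemma in_Act_0P (A : lact S) :
  in_Act_0 o A <-> exists theta : A, forall a : A, smul o a = theta.
Proof.
split=> -[theta h]; exists theta.
  move=> a; have : zeros o (smul o a) by exists a.
  by rewrite h.
apply/seteqP; split=> [_ [a _ <-]|_ ->]; first exact: h.
by exists theta => //; apply: h.
Qed.

(** From [s * o = o], every element of the form [smul o a] is fixed by the action; from [o * t = o],
    the action preserves the fibers of [smul o]. *)
Lemma smul_oC (A : lact S) (s t : S) (a b : A) :
  smul o a = b -> smul s b = b /\ smul o (smul t a) = b.
Proof. by move=> <-; rewrite -!smulM o_mulr o_mull. Qed.

Lemma subact_in_Act_0 (A : lact S) (D : set A) (hD : smul_closed D) (d : A) :
  in_Act_0 o A -> D d -> in_Act_0 o (subact hD).
Proof.
move=> /in_Act_0P[theta oA] Dd; apply/in_Act_0P.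
have Dt : D theta by rewrite -(oA d); apply: hD.
exists (exist _ theta (mem_set Dt)) => x.
exact/subact_eq/oA.
Qed.

(** * Rees quotients *)

Section Rees.
Variables (A : lact S) (z : A).
Hypothesis z_zero : smul o z = z.

(** Zeros are the elements fixed by [o], since [o * o = o]. This map is a normal form for the Rees
    congruence, so its fixed points encode the quotient. *)
Definition collapse (a : A) : A := if `[< smul o a = a >] then z else a.

Lemma collapse_zero a : smul o a = a -> collapse a = z.
Proof. by move=> h; rewrite /collapse asboolT. Qed.

Lemma collapse_nonzero a : smul o a <> a -> collapse a = a.
Proof. by move=> h; rewrite /collapse asboolF. Qed.

Lemma collapse_smul s a : collapse (smul s (collapse a)) = collapse (smul s a).
Proof.
have [h|h] := pselect (smul o a = a); last by rewrite (collapse_nonzero h).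
have [-> _] := smul_oC s 1 h.
rewrite (collapse_zero h); have [-> _] := smul_oC s 1 z_zero.
by rewrite !collapse_zero.
Qed.

Lemma collapseK a : collapse (collapse a) = collapse a.
Proof. by have := collapse_smul 1 a; rewrite !smul1. Qed.

Lemma collapse_inj a b : smul o b <> b -> collapse a = b -> a = b.
Proof.
move=> nb; have [h|h] := pselect (smul o a = a).
  by rewrite (collapse_zero h) => e; case: nb; rewrite -e.
by rewrite (collapse_nonzero h).
Qed.

(** All zeros of [A] go to the only zero of [B], so [f] factors through the Rees quotient. *)
Lemma hom_collapse (B : lact S) (f : A -> B) :
  in_Act_0 o B -> lact_hom f -> forall a, f (collapse a) = f a.
Proof.
move=> /in_Act_0P[theta oB] hf a.
have [h|h] := pselect (smul o a = a); last by rewrite (collapse_nonzero h).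
by rewrite (collapse_zero h) -h -z_zero !hf !oB.
Qed.

Definition rees_sort : Type := {a : A | collapse a = a}.

Definition rees_proj (a : A) : rees_sort := exist _ (collapse a) (collapseK a).

Lemma rees_eq (x y : rees_sort) : sval x = sval y -> x = y.
Proof. by case: x y => [x hx] [y hy] /= e; apply: eq_exist. Qed.

Definition rees_smul (s : S) (x : rees_sort) : rees_sort :=
  rees_proj (smul s (sval x)).

Fact rees_smul1 x : rees_smul 1 x = x.
Proof. by apply: rees_eq; rewrite /= smul1 (svalP x). Qed.

Fact rees_smulM s t x : rees_smul (s * t) x = rees_smul s (rees_smul t x).
Proof. by apply: rees_eq; rewrite /= collapse_smul smulM. Qed.

(* The Rees quotient of [A] by its zeros; they are represented by [z]. *)
Definition rees : lact S := Lact rees_smul1 rees_smulM.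

Lemma rees_in_Act_0 : in_Act_0 o rees.
Proof.
apply/in_Act_0P; exists (rees_proj z) => x; apply: rees_eq => /=.
by rewrite !collapse_zero //; have [] := smul_oC o 1 (erefl (smul o (sval x))).
Qed.

Lemma rees_proj_hom : lact_hom (rees_proj : A -> rees).
Proof. by move=> s a; apply: rees_eq; rewrite /= collapse_smul. Qed.

Lemma rees_projK (x : rees) : rees_proj (sval x) = x.
Proof. by apply: rees_eq; rewrite /= (svalP x). Qed.

Lemma rees_factor_hom (B : lact S) (f : A -> B) :
  in_Act_0 o B -> lact_hom f -> lact_hom (fun x : rees => f (sval x)).
Proof. by move=> B0 hf s x; rewrite /= (hom_collapse B0 hf) hf. Qed.

Lemma rees_projective :
  projective (@in_Act_bar S) A -> projective (in_Act_0 o) rees.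
Proof.
move=> projA B C B0 C0 pi alpha pi_epi alphah.
have [|beta betah e] := projA B C Logic.I Logic.I pi
  (alpha \o rees_proj) pi_epi.
  by move=> s a /=; rewrite rees_proj_hom alphah.
exists (fun x => beta (sval x)); first exact: rees_factor_hom.
apply/funext => x /=; have /= <- := congr1 (@^~ (sval x)) e.
by rewrite rees_projK.
Qed.

Lemma rees_cover (B : lact S) (f : A -> B) :
  in_Act_0 o B -> cover (@in_Act_bar S) f ->
  cover (in_Act_0 o) (fun x : rees => f (sval x)).
Proof.
move=> B0 [_ [hf f_surj] f_min].
split; first exact: rees_in_Act_0.
  split; first exact: rees_factor_hom.
  move=> b; have [a <-] := f_surj b.
  by exists (rees_proj a); apply: (hom_collapse B0 hf).
move=> D hD _ DT /(epi_subactP _ (rees_factor_hom B0 hf)) D_epi.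
(* Minimality is tested on the preimage of [D] in [A], which still maps onto [B]. *)
have hE : smul_closed [set a : A | D (rees_proj a)].
  by move=> s a /= Da; rewrite rees_proj_hom; apply: hD.
apply: (f_min _ hE) => //.
  move=> ET; apply: DT; apply/seteqP; split=> // x _.
  by rewrite -(rees_projK x); have : setT (sval x) by []; rewrite -ET.
apply/epi_subactP => // b; have [x Dx <-] := D_epi b.
by exists (sval x) => //=; rewrite rees_projK.
Qed.

End Rees.

Lemma left_perfect_0_perfect : left_perfect S -> left_0_perfect o.
Proof.
move=> perf A A0; have [P [f [f_cover projP]]] := perf A Logic.I.
(* [P] is nonempty because [A] is, so [smul o p] can represent the collapsed zeros. *)
have [theta _] := A0; have [_ [_ f_surj] _] := f_cover.
have [p _] := f_surj theta.
have [z_zero _] := smul_oC o 1 (erefl (smul o p)).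
exists (rees z_zero), (fun x => f (sval x)); split.
  exact: rees_cover.
exact: rees_projective.
Qed.

(** * One-element acts *)

Lemma point_projective (P : lact S) (theta : P) :
  (forall p, p = theta) -> projective (@in_Act_bar S) P.
Proof.
move=> pt A B _ _ pi alpha [pih pi_surj] alphah.
have [a ea] := pi_surj (alpha theta).
(* The lift must be a zero; [smul o a] still lies above [alpha theta], which is itself a zero. *)
exists (fun=> smul o a) => [s p|].
  by have [-> _] := smul_oC s 1 (erefl (smul o a)).
apply/funext => p; rewrite /= pih ea -alphah; congr alpha.
by rewrite (pt p) (pt (smul o theta)).
Qed.

Lemma point_cover (P A : lact S) (theta : P) (f : P -> A) :
  (forall p, p = theta) -> epi f -> cover (@in_Act_bar S) f.
Proof.
move=> pt f_epi; split=> // D hD _ DT /epi_subactP => /(_ f_epi.1) D_epi.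
have [p Dp _] := D_epi (f theta).
by apply: DT; apply/seteqP; split=> // q _; rewrite (pt q) -(pt p).
Qed.

(** * Free acts *)

Section FreeAct.
Variable X : Type.

Definition free_smul (s : S) (x : X * S) : X * S := (x.1, s * x.2).

Fact free_smul1 x : free_smul 1 x = x.
Proof. by case: x => x t; rewrite /free_smul mul1g. Qed.

Fact free_smulM s t x : free_smul (s * t) x = free_smul s (free_smul t x).
Proof. by rewrite /free_smul mulgA. Qed.

Definition free_act : lact S := Lact free_smul1 free_smulM.

Definition free_ext (A : lact S) (h : X -> A) (x : free_act) : A :=
  smul x.2 (h x.1).

Lemma free_ext_hom (A : lact S) (h : X -> A) : lact_hom (free_ext h).
Proof. by move=> s x; rewrite /free_ext smulM. Qed.

End FreeAct.

(** * Separating the glued zeros of a projective act *)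

Section Unglue.
Variables (P : lact S) (theta p0 : P).
Hypotheses (oP : forall p : P, smul o p = theta) (p0_neq : p0 <> theta).
Hypothesis projP : projective (in_Act_0 o) P.

Let X : Type := {p : P | p <> theta}.
Let F := free_act X.
Let pi0 : F -> P := free_ext (@sval _ _).
Let z : F := (exist _ p0 p0_neq, o).

Let P0 : in_Act_0 o P. Proof. by apply/in_Act_0P; exists theta. Qed.

Let z_zero : smul o z = z. Proof. by rewrite /= /free_smul o_mull. Qed.

Let pi0h : lact_hom pi0. Proof. exact: free_ext_hom. Qed.

Let F0 := rees z_zero.

(** Projectivity of [P] splits the surjection from [F0]. The section is read in [F] through normal
    forms, whence equivariance only up to [collapse]. *)
Lemma exists_section : exists b : P -> F,
  (forall s p, b (smul s p) = collapse z (smul s (b p))) /\ cancel b pi0.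
Proof.
have pi_epi : epi (fun x : F0 => pi0 (sval x)).
  split; first exact: rees_factor_hom.
  move=> p; have [->|np] := pselect (p = theta).
    exists (rees_proj z_zero z); rewrite /= (hom_collapse z_zero P0 pi0h).
    exact: oP.
  exists (rees_proj z_zero (exist _ p np, 1)).
  by rewrite /= (hom_collapse z_zero P0 pi0h) /pi0 /free_ext smul1.
have [//|b bh e] := @projP F0 P (rees_in_Act_0 z_zero) P0 _ id pi_epi.
exists (fun p => sval (b p)); split=> [s p|p]; first by rewrite bh.
by have /= <- := congr1 (@^~ p) e.
Qed.

Let b := projT1 (cid exists_section).
Let bM s p : b (smul s p) = collapse z (smul s (b p)).
Proof. by rewrite /b; case: cid => ? []. Qed.
Let bK : cancel b pi0. Proof. by rewrite /b; case: cid => ? []. Qed.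

(** As [pi0] sends zeros to [theta], [b (smul s p)] is not a zero, so [collapse] changed nothing. *)
Lemma section_eq (s : S) (p : P) :
  smul s p <> theta -> smul s (b p) = b (smul s p).
Proof.
move=> nsp; apply: (collapse_inj z_zero); last by rewrite -bM.
by move=> h; apply: nsp; rewrite -[LHS]bK -h pi0h oP.
Qed.

Let Q : set F := [set y | exists2 p, p <> theta & exists s, y = smul s (b p)].

Lemma unglue_closed : smul_closed Q.
Proof.
by move=> s _ [p np [t ->]]; exists p => //; exists (s * t); rewrite smulM.
Qed.

Definition unglue := subact unglue_closed.

Definition unglue_proj (y : unglue) : P := pi0 (subact_incl y).

Let Qgen p : p <> theta -> Q (b p).
Proof. by move=> np; exists p => //; exists 1; rewrite smul1. Qed.

Let gen (x : X) : unglue := exist _ (b (sval x)) (mem_set (Qgen (svalP x))).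

(** Write [b p] as [(x, t)], so that [t] times [x] is [p] by [bK]. The extension of [gen] sends it
    to [t] times [b x], which is [b p] by [section_eq]. Thus it retracts [F] onto [Q]. *)
Lemma free_ext_gen (y : unglue) : free_ext gen (subact_incl y) = y.
Proof.
apply: subact_eq; have [p np [s ->]] : Q (subact_incl y) := set_valP y.
rewrite (free_ext_hom gen) /=; congr (smul (l := F) s _).
rewrite -[RHS]/(b p) -[in RHS](bK p); apply: section_eq.
by rewrite -[smul _ _]/(pi0 (b p)) bK.
Qed.

(** Preimages chosen for the generators extend to [F], then restrict to its retract. *)
Lemma unglue_projective : projective (@in_Act_bar S) unglue.
Proof.
move=> A B _ _ pi alpha [pih pi_surj] alphah.
pose h x := projT1 (cid (pi_surj (alpha (gen x)))).
have hE x : pi (h x) = alpha (gen x) by rewrite /h; case: cid.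
exists (fun y => free_ext h (subact_incl y)).
  by move=> s y; apply: free_ext_hom.
apply/funext => y /=; rewrite -[in LHS](free_ext_gen y) /free_ext.
by rewrite alphah pih hE.
Qed.

Lemma unglue_proj_hom : lact_hom unglue_proj.
Proof. by move=> s y; apply: pi0h. Qed.

Lemma unglue_proj_surj p : exists y, unglue_proj y = p.
Proof.
have [->|np] := pselect (p = theta).
  exists (smul o (gen (exist _ p0 p0_neq))).
  by rewrite unglue_proj_hom.
by exists (gen (exist _ p np)); apply: bK.
Qed.

(** If [y] is [s] times [b q], its image [p] is [smul s q]; being nonzero, it allows [section_eq] to
    give [y] as [b p]. *)
Lemma unglue_proj_inj (y : unglue) p (np : p <> theta) :
  unglue_proj y = p -> y = gen (exist _ p np).
Proof.
move=> yp; apply: subact_eq; rewrite -[RHS]/(b p) -yp /unglue_proj.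
have [q nq [s e]] : Q (subact_incl y) := set_valP y.
have pq : pi0 (subact_incl y) = smul s q by rewrite e pi0h bK.
by rewrite pq {1}e; apply: section_eq; rewrite -pq -[pi0 _]/(unglue_proj y) yp.
Qed.

Lemma unglue_cover (A : lact S) (f : P -> A) :
  cover (in_Act_0 o) f -> cover (@in_Act_bar S) (f \o unglue_proj).
Proof.
move=> [_ [hf f_surj] f_min].
have fuh : lact_hom (f \o unglue_proj).
  by move=> s y /=; rewrite unglue_proj_hom hf.
split=> //.
  split=> // a; have [p <-] := f_surj a.
  by have [y <-] := unglue_proj_surj p; exists y.
move=> D hD _ DT /(epi_subactP _ fuh) D_epi; apply: DT.
pose E : set P := [set unglue_proj y | y in D].
have hE : smul_closed E.
  move=> s _ [y Dy <-]; exists (smul s y); first exact: hD.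
  exact: unglue_proj_hom.
have ET : E = setT.
  apply: contrapT => nE; apply: (f_min E hE) => //.
    (* Minimality of [f] concerns subacts with a zero; [E] has one because it is nonempty. *)
    have [y Dy _] := D_epi (f theta).
    by apply: (@subact_in_Act_0 _ _ _ (unglue_proj y)) => //; exists y.
  apply/epi_subactP => // a; have [y Dy <-] := D_epi a.
  by exists (unglue_proj y) => //; exists y.
(* A generator is the only preimage of its image in [P], so [D] must contain it. *)
have Dgen x : D (gen x).
  case: x => p np; have : setT p by [].
  by rewrite -ET => -[y Dy /(unglue_proj_inj np) <-].
apply/seteqP; split=> // y _; rewrite -(free_ext_gen y).
exact: hD.
Qed.

End Unglue.

Lemma Act_0_bar_cover (A : lact S) :
  in_Act_0 o A -> has_projective_cover (in_Act_0 o) A ->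
  has_projective_cover (@in_Act_bar S) A.
Proof.
move=> A0 [P [f [f_cover projP]]].
have [/in_Act_0P[theta oP] f_epi _] := f_cover.
(* If [P] is just [theta], the free act on its nonzero elements is empty; then [P] itself serves. *)
have [[p0 p0_neq]|triv] := pselect (exists p : P, p <> theta).
  exists (unglue oP p0_neq projP), (f \o @unglue_proj _ _ _ oP p0_neq projP).
  by split; [exact: unglue_cover | exact: unglue_projective].
have pt p : p = theta.
  by apply: contrapT => np; apply: triv; exists p.
exists P, f; split; first exact: point_cover f_epi.
exact: point_projective pt.
Qed.

(** Serves for the fibers over elements that are not zeros. *)
Lemma empty_has_projective_cover (A : lact S) :
  (A -> False) -> has_projective_cover (@in_Act_bar S) A.
Proof.
move=> A_empty; exists A, id; split; last first.
  move=> B C _ _ pi alpha _ _; exists (fun a => False_rect _ (A_empty a)).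
    by move=> s a; case: (A_empty a).
  by apply/funext => a; case: (A_empty a).
split=> // D hD _ [].
by apply/seteqP; split=> // a; case: (A_empty a).
Qed.

(** * Decomposition along multiplication by [o] *)

Section Fibers.
Variable A : lact S.

Definition fiber (z : A) : set A := [set a | smul o a = z].

Lemma fiber_closed z : smul_closed (fiber z).
Proof. by move=> s a /(smul_oC s s)[]. Qed.

Lemma fiber_in_Act_0 z a : fiber z a -> in_Act_0 o (subact (@fiber_closed z)).
Proof.
move=> az; apply/in_Act_0P.
have zz : fiber z z by have [] := smul_oC o 1 az.
by exists (exist _ z (mem_set zz)) => x; apply/subact_eq/(set_valP x).
Qed.

Lemma fibers_has_projective_cover :
  (forall z, has_projective_cover (@in_Act_bar S) (subact (@fiber_closed z))) ->
  has_projective_cover (@in_Act_bar S) A.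
Proof.
move=> covA.
pose P z := projT1 (cid (covA z)).
pose f z : P z -> _ := projT1 (cid (projT2 (cid (covA z)))).
have fP z : cover (@in_Act_bar S) (f z) /\ projective (@in_Act_bar S) (P z).
  exact: projT2 (cid (projT2 (cid (covA z)))).
pose g (x : coprod P) : A := subact_incl (f _ (projT2 x)).
have gh : lact_hom g.
  by move=> s [z p]; have [[_ [fh _] _] _] := fP z; rewrite /g /= fh.
exists (coprod P), g; split; last first.
  by apply: coprod_projective => z; have [] := fP z.
split=> //.
  split=> // a; have [[_ [_ f_surj] _] _] := fP (smul o a).
  have [p e] := f_surj (exist _ a (mem_set (erefl : fiber (smul o a) a))).
  by exists (coprod_in p); rewrite /g /= e.
move=> D hD _ DT /(epi_subactP _ gh) D_epi; apply: DT.
apply/seteqP; split=> // -[z p] _.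
have [[_ [fh _] f_min] _] := fP z.
have hE : smul_closed [set q : P z | D (coprod_in q)].
  by move=> s q; apply: hD.
suff ET : [set q : P z | D (coprod_in q)] = setT.
  by have : setT p by []; rewrite -ET.
apply: contrapT => nE; apply: (f_min _ hE) => //.
apply/epi_subactP => // a; have [[z' q] Dq gq] := D_epi (subact_incl a).
(* The summand containing [q] is determined by its image: its index is [o] times that image. *)
have zE : z' = z.
  rewrite -(set_valP a : smul o (subact_incl a) = z) -gq.
  by rewrite (set_valP (f z' q) : smul o (subact_incl _) = z').
move: q Dq gq; rewrite zE => q Dq gq; exists q => //.
exact: subact_eq.
Qed.

End Fibers.

Lemma left_0_perfect_perfect : left_0_perfect o -> left_perfect S.
Proof.
move=> perf A _; apply: fibers_has_projective_cover => z.
have [[a az]|fiber0] := pselect (exists a, fiber z a).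
  have fib0 := fiber_in_Act_0 az.
  exact: Act_0_bar_cover (perf _ fib0).
apply: empty_has_projective_cover => x.
by apply: fiber0; exists (subact_incl x); apply: set_valP.
Qed.

End Zero.

Theorem theorem18 (S : monoidType) (o : S)
    (o_mull : forall s : S, o * s = o) (o_mulr : forall s : S, s * o = o)
    (o_neq1 : o <> 1) :
  left_perfect S <-> left_0_perfect o.
Proof.
split; first exact: left_perfect_0_perfect.
exact: left_0_perfect_perfect.
Qed.
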